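(* Let $\theta>0$ and let $f$ and $g$ be two functions defined on $(0,\infty)$ such that $g=f^{-1}$ is the inverse function of $f$, and $g'(x)<0$, $g''(x)>0$, $g'''(x)<0$ for all $x\in(0,\infty)$. Then there exists a constant $C>0$ such that for every $T>0$ and every random variable $F$ with $F>0$ almost surely, $\mathbb E F<\infty$ and $f(F)>0$ almost surely, $$d_{Kol}\left(\sqrt T\,(f(F)-\theta),N\right)\le C\left[d_{Kol}\left(\frac{\sqrt T}{|g'(\theta)|}(F-\mathbb E F),N\right)+\sqrt T\,\left|\mathbb E F-g(\theta)\right|+\frac1{\sqrt T}\right],$$ where $N\sim\mathcal N(0,1)$. (In particular $C$ is independent of $T$ and $F$.)
   Context: $d_{Kol}(U,V)=\sup_{z\in\mathbb R}|P(U\le z)-P(V\le z)|$. The constant $C$ may depend on $\theta$, $f$ and $g$. *)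

(* Defs.v *)
From HB Require Import structures.
From mathcomp Require Import all_boot all_order all_algebra.
From mathcomp Require Import all_classical all_reals all_analysis.

Set Implicit Arguments.
Unset Strict Implicit.
Unset Printing Implicit Defensive.

Import Order.TTheory GRing.Theory Num.Theory.
Import numFieldNormedType.Exports.

Local Open Scope ring_scope.
Local Open Scope classical_set_scope.

(* The real supremum is meaningful: the set is nonempty and bounded by 1. [U]
   and [V] are meant to be measurable; they may live on different probability
   spaces. *)
Definition dKol d d' (Omega : measurableType d) (Omega' : measurableType d')
    (R : realType) (P : probability Omega R) (Q : probability Omega' R)
    (U : Omega -> R) (V : Omega' -> R) : R :=
  sup [set `|fine (P [set w | U w <= z]) - fine (Q [set w | V w <= z])|
      | z in [set: R]].

(* The equality is only required on measurable sets, since the values of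
   measures on other sets are junk. *)
Definition standard_normal d (Omega : measurableType d) (R : realType)
    (P : probability Omega R) (N : {RV P >-> R}) : Prop :=
  forall A : set R, measurable A -> distribution P N A = normal_prob 0 1 A.

(* [g = f^-1] for [f] and [g] defined on the positive half-line. The values of
   [f] there are not assumed to be positive: the case of a bijection of the
   positive half-line is the one where [0 < f y] holds for all [y > 0]. Values
   of [f] and [g] at nonpositive points are irrelevant. *)
Definition inverse_on_pos (R : realType) (f g : R -> R) : Prop :=
  [/\ forall x : R, 0 < x -> 0 < g x,
      forall x : R, 0 < x -> f (g x) = x &
      forall y : R, 0 < y -> 0 < f y -> g (f y) = y].

(* Main.v *)
Require Import Defs.
From HB Require Import structures.
From mathcomp Require Import all_boot all_order all_algebra.
From mathcomp Require Import all_classical all_reals all_analysis.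
From mathcomp Require Import measurable_realfun.
From mathcomp Require Import ring lra.

Set Implicit Arguments.
Unset Strict Implicit.
Unset Printing Implicit Defensive.

Import Order.TTheory GRing.Theory Num.Theory.
Import numFieldNormedType.Exports.

Local Open Scope ring_scope.
Local Open Scope classical_set_scope.

(** Write [Phi] for the standard normal distribution function, [s] for the
square root of [T], [a = |g'(theta)|], and put [z = s * h].  As [g = f^-1] is
decreasing, the event [s * (f F - theta) <= z] is, up to a null set, the event
[F >= g (theta + h)] as soon as [theta + h > 0].  After standardising [F] this
is a half-line event for [U = (s / a) * (F - m)], so its probability is within
the distance of [U] to the normal law of [1 - Phi u = Phi (- u)], with
[u = (s / a) * (g (theta + h) - m)] ([dKol_normal_ge_lt], [normal_cdfN]).
Since [Phi] is 1-Lipschitz, replacing [m] by [g theta] in [u] costs at most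
[(s / a) * |m - g theta|].  There remains the deterministic estimate

  [|Phi (s * d) - Phi (s * h)| <= C / s],
  [d = (g theta - g (theta + h)) / a],

uniformly in [h] ([normal_cdf_decrement]).  Its two arguments agree to first
order at [h = 0].

- For small [|h|], Taylor's formula gives [0 <= h - d <= K * h ^ 2], so the
  arguments of [Phi] differ by at most [K * s * h ^ 2].  This is not bounded in
  [z], but the normal density is at most [1 / x ^ 2] and [d] is at least a
  multiple of [h]: the increment of [Phi] is at most of order
  [K * s * h ^ 2 / (s * h) ^ 2 = K / s].
- For [h] away from 0, both arguments are on the same side of the origin at a
  distance at least of order [s], and the normal tail at [t] is at most [2 / t].

If [theta + h <= 0] the event is null, since [f F > 0], and [Phi z] is again a
normal tail at distance at least [s * theta]. *)

(** * The standard normal distribution function *)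

Definition normal_cdf {R : realType} (z : R) : R :=
  fine (normal_prob 0 1 `]-oo, z]).

Lemma normal_pdf01E {R : realType} (x : R) :
  normal_pdf 0 1 x = normal_peak 1 * expR (- x ^+ 2 / 2).
Proof.
by rewrite normal_pdfE ?oner_eq0// /normal_fun subr0 expr1n.
Qed.

Lemma normal_peak1_le {R : realType} : normal_peak (1 : R) <= 2^-1.
Proof.
rewrite /normal_peak lef_pV2 ?posrE ?sqrtr_gt0; last 2 first.
- by rewrite expr1n mul1r mulrn_wgt0// pi_gt0.
- by [].
have -> : 2 = Num.sqrt (2 ^+ 2) :> R by rewrite sqrtr_sqr ger0_norm.
rewrite expr1n mul1r ler_wsqrtr// -[pi *+ 2]mulr_natr expr2 ler_wpM2r//.
exact: pi_ge2.
Qed.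

Lemma normal_pdf01_le1 {R : realType} (x : R) : normal_pdf 0 1 x <= 1.
Proof.
apply: le_trans (normal_pdf_ub _ _ (oner_neq0 R)) _.
by apply: le_trans normal_peak1_le _; lra.
Qed.

(** From [exp y >= y] at [y = x ^ 2 / 2]: a polynomial decay of the density is
all that the estimates of increments and tails require. *)
Lemma normal_pdf01_le_sqr {R : realType} (M x : R) : 0 < M -> M <= `|x| ->
  normal_pdf 0 1 x <= M ^- 2.
Proof.
move=> M0 Mx.
have Mx2 : M ^+ 2 <= x ^+ 2.
  by rewrite -(real_normK (num_real x)) lerXn2r// nnegrE ltW.
have M2 : 0 < M ^+ 2 by rewrite exprn_gt0.
rewrite normal_pdf01E mulNr expRN.
apply: (@le_trans _ _ (2^-1 * (x ^+ 2 / 2)^-1)).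
  rewrite ler_pM ?normal_peak_ge0 ?invr_ge0 ?expR_ge0 ?normal_peak1_le//.
  rewrite lef_pV2 ?posrE ?expR_gt0//; last by lra.
  by apply: le_trans (expR_ge1Dx _); lra.
by rewrite invf_div mulKf ?pnatr_eq0// lef_pV2 ?posrE//; lra.
Qed.

Lemma normal_cdf_le1 {R : realType} (z : R) : normal_cdf z <= 1.
Proof. by rewrite -lee_fin fineK ?fin_num_measure ?probability_le1. Qed.

Lemma normal_cdf_ge0 {R : realType} (z : R) : 0 <= normal_cdf z.
Proof. by rewrite fine_ge0. Qed.

Lemma normal_cdf_le {R : realType} (a b : R) : a <= b ->
  normal_cdf a <= normal_cdf b.
Proof.
move=> ab; rewrite fine_le ?fin_num_measure ?le_measure ?inE//.
exact: subitvPr.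
Qed.

Lemma normal_cdf_increment {R : realType} (k a b : R) : a <= b ->
  (forall x, a < x <= b -> normal_pdf 0 1 x <= k) ->
  normal_cdf b - normal_cdf a <= k * (b - a).
Proof.
move=> ab abk.
have -> : normal_cdf b - normal_cdf a = fine (normal_prob 0 1 `]a, b]).
  rewrite /normal_cdf (@itv_bndbnd_setU _ _ _ (BRight a))// measureU//=.
    by rewrite fineD ?fin_num_measure// addrC addKr.
  apply/seteqP; split => // x [/=]; rewrite !in_itv/= => xa /andP[ax _].
  by move: (lt_le_trans ax xa); rewrite ltxx.
rewrite -lee_fin fineK ?fin_num_measure// /normal_prob.
apply: (@le_trans _ _ (\int[lebesgue_measure]_(x in `]a, b]) k%:E)%E).
  apply: ge0_le_integral => //=.
    by move=> x _; rewrite lee_fin normal_pdf_ge0.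
  by apply/measurable_EFinP/measurable_funTS; exact: measurable_normal_pdf.
rewrite integral_cst//= lebesgue_measure_itv/= lte_fin.
case: ifPn => [_|]; first by rewrite -EFinB -EFinM.
by rewrite -leNgt => ba; rewrite (@le_anti _ R a b) ?ab// mule0 subrr mulr0.
Qed.

Lemma normal_cdf_lipschitz {R : realType} (a b : R) :
  `|normal_cdf b - normal_cdf a| <= `|b - a|.
Proof.
wlog ab : a b / a <= b.
  move=> W; have [|/ltW] := leP a b; first exact: W.
  by rewrite distrC (distrC b); exact: W.
rewrite !ger0_norm ?subr_ge0 ?normal_cdf_le//.
rewrite -[leRHS]mul1r; apply: normal_cdf_increment => // x _.
exact: normal_pdf01_le1.
Qed.

Lemma normal_cdf_increment_away {R : realType} (M a b : R) : a <= b -> 0 < M ->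
  (forall x, a < x <= b -> M <= `|x|) ->
  normal_cdf b - normal_cdf a <= (b - a) / M ^+ 2.
Proof.
move=> ab M0 h; rewrite mulrC; apply: normal_cdf_increment => // x /h.
exact: normal_pdf01_le_sqr.
Qed.

Lemma normal_cdfN {R : realType} (z : R) : normal_cdf (- z) = 1 - normal_cdf z.
Proof.
have -> : 1 - normal_cdf z = fine (normal_prob 0 1 `]z, +oo[).
  rewrite -[in RHS]setCitvl probability_setC// fineB ?fin_num_measure//.
congr fine; rewrite /normal_prob.
rewrite ge0_integration_by_substitutionNy//; last 2 first.
- apply/continuous_subspaceT/continuous_normal_pdf; exact: oner_neq0.
- by move=> x _; exact: normal_pdf_ge0.
rewrite integral_itv_obnd_cbnd.
  by apply: eq_integral => x _ /=; rewrite !normal_pdf01E sqrrN.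
by apply/measurable_EFinP/measurable_funTS; exact: measurable_normal_pdf.
Qed.

(** The density bound applied on the dyadic block [[- 2 s, - s]] gives the
increment at most [1 / s = 2 / s - 2 / (2 s)], so [Phi (- s) - 2 / s] does not
decrease when [s] is doubled; along [2 ^ n * t] its limit superior is at most
0. *)
Lemma normal_cdf_tail {R : realType} (t : R) : 0 < t ->
  normal_cdf (- t) <= 2 / t.
Proof.
move=> t0.
have dyadic (s : R) : 0 < s ->
    normal_cdf (- s) - 2 / s <= normal_cdf (- (2 * s)) - 2 / (2 * s).
  move=> s0.
  have : normal_cdf (- s) - normal_cdf (- (2 * s)) <=
      (- s - - (2 * s)) / s ^+ 2.
    apply: normal_cdf_increment_away => //; first by lra.
    by move=> x /andP[_ xs]; rewrite ler0_norm; lra.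
  have -> : (- s - - (2 * s)) / s ^+ 2 = 2 / s - 2 / (2 * s).
    by field; rewrite gt_eqF.
  by lra.
have t2 n : 0 < 2 ^+ n * t by rewrite mulr_gt0 ?exprn_gt0.
have iter n : normal_cdf (- t) - 2 / t <= normal_cdf (- (2 ^+ n * t)).
  apply: (@le_trans _ _ (normal_cdf (- (2 ^+ n * t)) - 2 / (2 ^+ n * t))).
    elim: n => [|n IH]; first by rewrite expr0 mul1r.
    by apply: le_trans IH _; rewrite exprS -mulrA; exact: dyadic.
  by rewrite gerBl divr_ge0// ltW.
pose F n := `]-oo, (- (2 ^+ n * t))] : set R.
have mF n : measurable (F n) by exact: measurable_itv.
have F0 : \bigcap_n F n = set0.
  rewrite -subset0 => x Fx.
  have /(_ I) := Fx (Num.bound (- x / t)).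
  rewrite /F/= in_itv/= leNgt => /negP; apply.
  by rewrite ltrNl -ltr_pdivrMr// upper_nthrootP.
have : (normal_prob 0 1 \o F) n @[n --> \oo] -->
    normal_prob 0 1 (\bigcap_n F n).
  apply: nonincreasing_cvg_mu => //=.
  - by rewrite ltey_eq fin_num_measure//; exact: mF.
  - by rewrite F0.
  - move=> m n mn; apply/subsetPset => x.
    rewrite /F/= !in_itv/= => /le_trans; apply.
    by rewrite lerN2 ler_pM2r// ler_weXn2l ?ler1n.
rewrite F0 measure0 => /fine_cvg H.
rewrite -subr_le0 -[leRHS](cvg_lim _ H)//.
apply: limr_ge; first by apply/cvg_ex; eexists; exact: H.
by near=> n; exact: iter.
Unshelve. all: by end_near. Qed.

(** An error [h - d] of second order at [h = 0] only costs [C / s] after scaling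
by [s]: near 0 the factor [(s * h) ^ -2] of the density bound cancels the
quadratic error, and for [|h| > r] both points lie in the same tail.  On the
positive side [d] is the point closer to the origin, hence the lower bounds
[c * h] and [c * r] on [d]; on the negative side [h] itself is. *)
Lemma normal_cdf_scale {R : realType} (r K c s h d : R) :
  0 < r -> 0 < K -> 0 < c -> 0 < s -> d <= h ->
  (`|h| <= r -> h - d <= K * h ^+ 2) ->
  (0 < h <= r -> c * h <= d) ->
  (r <= h -> c * r <= d) ->
  `|normal_cdf (s * d) - normal_cdf (s * h)| <=
    (K + K / c ^+ 2 + 2 / r + 2 / (c * r)) / s.
Proof.
move=> r0 K0 c0 s0 dh hK hc hr.
set C := K + _ + _ + _.
have B (x : R) : x <= C -> x / s <= C / s.
  by move=> ?; rewrite ler_pM2r ?invr_gt0.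
have Kc0 : 0 < K / c ^+ 2 by rewrite divr_gt0 ?exprn_gt0.
have r20 : 0 < 2 / r by rewrite divr_gt0.
have cr20 : 0 < 2 / (c * r) by rewrite divr_gt0 ?mulr_gt0.
have sdh : s * d <= s * h by rewrite ler_pM2l.
rewrite distrC ger0_norm ?subr_ge0 ?normal_cdf_le//.
have away (M : R) : 0 < M -> `|h| <= r ->
    (forall x, s * d < x <= s * h -> s * M * `|h| <= `|x|) -> h != 0 ->
    normal_cdf (s * h) - normal_cdf (s * d) <= K / M ^+ 2 / s.
  move=> M0 /hK hdK Mx h0.
  have nh0 : 0 < `|h| by rewrite normr_gt0.
  apply: le_trans (normal_cdf_increment_away sdh _ Mx) _.
    by rewrite !mulr_gt0.
  rewrite ler_pdivrMr; last by rewrite exprn_gt0// !mulr_gt0.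
  rewrite !exprMn real_normK ?num_real//.
  have -> : K / M ^+ 2 / s * (s ^+ 2 * M ^+ 2 * h ^+ 2) = s * (K * h ^+ 2).
    by field; rewrite !gt_eqF.
  by rewrite -mulrBr ler_pM2l.
have [hr'|hr'] := ltP h (- r).
  apply: le_trans (B (2 / r) _); last by rewrite /C; lra.
  apply: (@le_trans _ _ (normal_cdf (- (s * r)))).
    apply: (@le_trans _ _ (normal_cdf (s * h))).
      by rewrite gerBl normal_cdf_ge0.
    by apply: normal_cdf_le; rewrite -mulrN ler_pM2l// ltW.
  rewrite -mulrA -invfM [r * s]mulrC; apply: normal_cdf_tail; exact: mulr_gt0.
have [hr2|hr2] := leP h r; last first.
  apply: le_trans (B (2 / (c * r)) _); last by rewrite /C; lra.
  apply: (@le_trans _ _ (normal_cdf (- (s * d)))).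
    by rewrite normal_cdfN lerD2r normal_cdf_le1.
  apply: (@le_trans _ _ (normal_cdf (- (s * (c * r))))).
    by apply: normal_cdf_le; rewrite lerN2 ler_pM2l// hr// ltW.
  rewrite -[2 / _ / _]mulrA -invfM [c * r * s]mulrC.
  by apply: normal_cdf_tail; rewrite !mulr_gt0.
have nhr : `|h| <= r by rewrite ler_norml hr' hr2.
have [h0|h0|h0] := ltgtP h 0.
- apply: le_trans (B K _); last by rewrite /C; lra.
  rewrite -[K in leRHS]divr1 -[1 in leRHS](expr1n _ 2).
  apply: away; rewrite ?lt_eqF// => x /andP[_ xh].
  have xn : x < 0 by apply: le_lt_trans xh _; rewrite pmulr_rlt0.
  by rewrite mulr1 !ltr0_norm// mulrN lerN2.
- apply: le_trans (B (K / c ^+ 2) _); last by rewrite /C; lra.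
  apply: away; rewrite ?gt_eqF// => x /andP[dx _].
  have : s * (c * h) <= s * d by rewrite ler_pM2l// hc// h0.
  rewrite mulrA (gtr0_norm h0) => H.
  by rewrite (le_trans H)// (le_trans (ltW dx))// ler_norm.
- have d0 : d = 0.
    apply/eqP; rewrite eq_le -{1}h0 dh/=.
    by move: (hK nhr); rewrite h0 expr0n/= mulr0 sub0r oppr_le0.
  by rewrite d0 h0 subrr divr_ge0 ?(ltW s0)// /C; lra.
Qed.

(** * Decrements of a decreasing convex function *)

Section calculus.
Context {R : realType}.
Implicit Types (g : R -> R) (x y a b : R).

Lemma MVT_pos g a b : (forall x, 0 < x -> derivable g x 1) ->
  0 < a -> a < b -> exists2 c, a < c < b &
    g b - g a = g^`()%classic c * (b - a).
Proof.
move=> dg a0 ab.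
have [||c cab gc] := @MVT R g g^`()%classic a b ab.
- move=> x; rewrite in_itv/= => /andP[ax _].
  by rewrite derive1E; apply/derivableP/dg/(lt_trans a0).
- apply: derivable_within_continuous => x; rewrite in_itv/= => /andP[ax _].
  exact/dg/(lt_le_trans a0).
by exists c.
Qed.

Lemma decreasing_pos g : (forall x, 0 < x -> derivable g x 1) ->
  (forall x, 0 < x -> g^`()%classic x < 0) ->
  forall x y, 0 < x -> x < y -> g y < g x.
Proof.
move=> dg g'0 x y x0 xy; have [c /andP[xc _] gc] := MVT_pos dg x0 xy.
by rewrite -subr_lt0 gc pmulr_llt0 ?subr_gt0// g'0// (lt_trans x0).
Qed.

Lemma increasing_pos g : (forall x, 0 < x -> derivable g x 1) ->
  (forall x, 0 < x -> 0 < g^`()%classic x) ->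
  forall x y, 0 < x -> x < y -> g x < g y.
Proof.
move=> dg g'0 x y x0 xy; have [c /andP[xc _] gc] := MVT_pos dg x0 xy.
by rewrite -subr_gt0 gc pmulr_lgt0 ?subr_gt0// g'0// (lt_trans x0).
Qed.

End calculus.

Section increments.
Context {R : realType} (g : R -> R).
Local Notation g' := g^`()%classic.
Local Notation g'' := g^`(2)%classic.
Context (dg : forall x, 0 < x ->
  [/\ derivable g x 1, derivable g' x 1 & derivable g'' x 1]).
Context (g1 : forall x, 0 < x -> g' x < 0).
Context (g2 : forall x, 0 < x -> 0 < g'' x).
Context (g3 : forall x, 0 < x -> g^`(3)%classic x < 0).
Implicit Types t h x : R.

Let dg0 x : 0 < x -> derivable g x 1. Proof. by move=> /dg[]. Qed.
Let dg1 x : 0 < x -> derivable g' x 1. Proof. by move=> /dg[]. Qed.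
Let dg2 x : 0 < x -> derivable g'' x 1. Proof. by move=> /dg[]. Qed.

Let g1_lt x y : 0 < x -> x < y -> g' x < g' y.
Proof. exact: (increasing_pos dg1 g2). Qed.

(** The graph of the convex function [g] lies above its tangent at [t]. *)
Lemma decrement_le_tangent t h : 0 < t -> 0 < t + h ->
  g t - g (t + h) <= - g' t * h.
Proof.
move=> t0 th0; have [h0|h0|->] := ltgtP h 0; last first.
- by rewrite addr0 subrr mulr0.
- have tth : t < t + h by rewrite ltrDl.
  have [c /andP[tc _] gc] := MVT_pos dg0 t0 tth.
  have := g1_lt t0 tc.
  rewrite -opprB gc addrAC subrr add0r -mulNr ler_pM2r// => ?; lra.
- have tth : t + h < t by rewrite gtrDl.
  have [c /andP[tc ct] ->] := MVT_pos dg0 th0 tth.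
  have := g1_lt (lt_trans th0 tc) ct.
  rewrite opprD addrA subrr sub0r mulrN mulNr lerN2 ler_nM2r// => /ltW; lra.
Qed.

(** Two applications of the mean value theorem; [g''] decreases, so its value
at [t / 2] dominates all those at the intermediate points. *)
Lemma decrement_ge_tangent t h : 0 < t -> `|h| <= t / 2 ->
  - g' t * h - (g t - g (t + h)) <= g'' (t / 2) * h ^+ 2.
Proof.
move=> t0; rewrite ler_norml => /andP[ht1 ht2].
have g2_le x : t / 2 < x -> g'' x <= g'' (t / 2).
  by move=> tx; apply/ltW/(decreasing_pos dg2 g3) => //; rewrite divr_gt0.
have K0 : 0 < g'' (t / 2) by rewrite g2// divr_gt0.
have [h0|h0|->] := ltgtP h 0; last first.
- by rewrite addr0 subrr mulr0 expr0n/= mulr0 subrr.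
- have tth : t < t + h by rewrite ltrDl.
  have [c /andP[tc cth] gc] := MVT_pos dg0 t0 tth.
  have ch : c - t <= h by lra.
  have [e /andP[te ec] ge] := MVT_pos dg1 t0 tc.
  have := g2_le e.
  have -> : - g' t * h - (g t - g (t + h)) = g'' e * ((c - t) * h).
    rewrite mulrA; rewrite [g'' e * _](esym ge); move: gc; lra.
  have te2 : t / 2 < e by lra.
  move=> /(_ te2) ge2; apply: le_trans (_ : g'' (t / 2) * ((c - t) * h) <= _).
    by rewrite ler_pM2r// mulr_gt0// subr_gt0.
  apply: ler_wpM2l; first exact: ltW.
  by rewrite expr2; apply: ler_wpM2r => //; exact: ltW.
- have th0 : 0 < t + h by lra.
  have tth : t + h < t by rewrite gtrDl.
  have [c /andP[tc cth] gc] := MVT_pos dg0 th0 tth.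
  have c0 : 0 < c by lra.
  have ch : t - c <= - h by lra.
  have [e /andP[te ec] ge] := MVT_pos dg1 c0 cth.
  have -> : - g' t * h - (g t - g (t + h)) = g'' e * ((t - c) * - h).
    rewrite mulrA; rewrite [g'' e * _](esym ge) gc; ring.
  have te2 : t / 2 < e by lra.
  have ge2 := g2_le _ te2.
  apply: le_trans (_ : g'' (t / 2) * ((t - c) * - h) <= _).
    by rewrite ler_pM2r// mulr_gt0 ?subr_gt0// oppr_gt0.
  apply: ler_wpM2l; first exact: ltW.
  by rewrite -(sqrrN h) expr2; apply: ler_wpM2r => //; rewrite oppr_ge0 ltW.
Qed.

Lemma decrement_ge_secant t r h : 0 < t -> 0 < h <= r ->
  - g' (t + r) * h <= g t - g (t + h).
Proof.
move=> t0 /andP[h0 hr].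
have tth : t < t + h by rewrite ltrDl.
have [c /andP[tc cth] gc] := MVT_pos dg0 t0 tth.
have ctr : c < t + r by lra.
have := g1_lt (lt_trans t0 tc) ctr.
rewrite -opprB gc addrAC subrr add0r -mulNr ler_pM2r// => ?; lra.
Qed.

Lemma decrement_ge_far t r h : 0 < t -> 0 < r <= h ->
  - g' (t + r) * r <= g t - g (t + h).
Proof.
move=> t0 /andP[r0 rh].
have := @decrement_ge_secant t r r t0; rewrite r0 lexx => /(_ isT) H.
apply: le_trans H _; rewrite lerD2l lerN2.
move: rh; rewrite le_eqVlt => /predU1P[->//|rh].
by apply/ltW/(decreasing_pos dg0 g1); lra.
Qed.

(** The linearisation error of [g] at [t], seen through [Phi].  Small [h] means
[|h| <= t / 2]: then [t + h] stays in [[t / 2, 3 t / 2]], away from the origin,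
where [g''] may blow up. *)
Lemma normal_cdf_decrement t : 0 < t -> exists2 C, 0 < C &
  forall s h, 0 < s -> 0 < t + h ->
  `|normal_cdf (s * ((g t - g (t + h)) / `|g' t|)) - normal_cdf (s * h)|
    <= C / s.
Proof.
move=> t0; set a := `|g' t|.
have aE : a = - g' t by rewrite /a ltr0_norm ?g1.
have a0 : 0 < a by rewrite aE oppr_gt0 g1.
pose r := t / 2; pose K := g'' r / a; pose c := - g' (t + r) / a.
have r0 : 0 < r by rewrite divr_gt0.
have K0 : 0 < K by rewrite divr_gt0// g2.
have c0 : 0 < c by rewrite divr_gt0// oppr_gt0 g1// addr_gt0.
exists (K + K / c ^+ 2 + 2 / r + 2 / (c * r)).
  have Kc0 : 0 < K / c ^+ 2 by rewrite divr_gt0// exprn_gt0.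
  have r20 : 0 < 2 / r by rewrite divr_gt0.
  have cr20 : 0 < 2 / (c * r) by rewrite divr_gt0// mulr_gt0.
  by move: K0; lra.
move=> s h s0 th0; apply: normal_cdf_scale => //.
- by rewrite ler_pdivrMr// mulrC aE decrement_le_tangent.
- move=> hr; rewrite -(ler_pM2l a0) mulrBr mulrCA divff ?gt_eqF// mulr1.
  rewrite mulrA [a * K]mulrC divfK ?gt_eqF// aE.
  exact: decrement_ge_tangent.
- move=> hr; rewrite ler_pdivlMr// mulrAC divfK ?gt_eqF//.
  exact: decrement_ge_secant.
- move=> rh; rewrite ler_pdivlMr// mulrAC divfK ?gt_eqF//.
  by apply: decrement_ge_far; rewrite ?r0.
Qed.

End increments.

(** * Kolmogorov distance to a standard normal variable *)

Section kolmogorov.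
Context {d d' : measure_display} {R : realType}.
Context {Omega : measurableType d} {Omega' : measurableType d'}.
Context (P : probability Omega R) {Q : probability Omega' R}.
Implicit Types (U : Omega -> R) (N : {RV Q >-> R}).

Lemma standard_normal_cdf N z : standard_normal N ->
  fine (Q [set w | N w <= z]) = normal_cdf z.
Proof.
move=> nN; rewrite /normal_cdf -nN//; congr (fine (Q _)).
Qed.

Lemma measurable_le U z : measurable_fun setT U ->
  measurable [set w | U w <= z].
Proof.
move=> mU; rewrite -[X in measurable X]setTI.
have := mU measurableT `]-oo, z] (measurable_itv _).
by [].
Qed.

Lemma measurable_lt U z : measurable_fun setT U ->
  measurable [set w | U w < z].
Proof.
move=> mU; rewrite -[X in measurable X]setTI.
have := mU measurableT `]-oo, z[ (measurable_itv _).
by [].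
Qed.

Lemma dKol_normal_ge U N z : measurable_fun setT U -> standard_normal N ->
  `|fine (P [set w | U w <= z]) - normal_cdf z| <= dKol P Q U N.
Proof.
move=> mU nN; apply: ub_le_sup; last first.
  by exists z => //; rewrite standard_normal_cdf.
exists 1 => _ [x _ <-]; rewrite standard_normal_cdf//.
have p0 : 0 <= fine (P [set w | U w <= x]) by rewrite fine_ge0.
have p1 : fine (P [set w | U w <= x]) <= 1.
  have mUx := measurable_le x mU.
  by rewrite -lee_fin fineK ?fin_num_measure ?probability_le1.
have := normal_cdf_ge0 x; have := normal_cdf_le1 x.
by move=> ? ?; rewrite ler_norml; apply/andP; split; lra.
Qed.

(** Strict inequalities come from the comparison at [z - e] and the continuity
of [Phi]. *)
Lemma dKol_normal_ge_lt U N z : measurable_fun setT U -> standard_normal N ->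
  `|fine (P [set w | U w < z]) - normal_cdf z| <= dKol P Q U N.
Proof.
move=> mU nN.
have le_P (A B : set Omega) : measurable A -> measurable B -> A `<=` B ->
    fine (P A) <= fine (P B).
  by move=> mA mB AB; rewrite fine_le ?fin_num_measure// le_measure ?inE.
have mlt := measurable_lt z mU.
rewrite ler_norml; apply/andP; split; last first.
  apply: le_trans (le_trans (ler_norm _) (dKol_normal_ge z mU nN)).
  rewrite lerD2r; apply: le_P => //; first exact: measurable_le.
  by move=> w /= /ltW.
apply/ler_addgt0Pr => e e0.
have := dKol_normal_ge (z - e) mU nN; rewrite ler_norml => /andP[D _].
have : fine (P [set w | U w <= z - e]) <= fine (P [set w | U w < z]).
  apply: le_P => //; first exact: measurable_le.
  by move=> w /= /le_lt_trans; apply; lra.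
have := normal_cdf_lipschitz (z - e) z.
have -> : z - (z - e) = e by lra.
by rewrite ger0_norm ?subr_ge0 ?normal_cdf_le ?(gtr0_norm e0)//; lra.
Qed.

Lemma dKol_normal_le U N M : standard_normal N ->
  (forall z, `|fine (P [set w | U w <= z]) - normal_cdf z| <= M) ->
  dKol P Q U N <= M.
Proof.
move=> nN UM; apply: ge_sup; first by eexists; exists 0.
by move=> _ [z _ <-]; rewrite standard_normal_cdf.
Qed.

Lemma ae_measure_eq (A B : set Omega) : measurable A -> measurable B ->
  {ae P, forall w, A w <-> B w} -> P A = P B.
Proof.
move=> mA mB [N [mN N0 ABN]].
have le_P (X Y : set Omega) : measurable X -> measurable Y ->
    X `<=` Y `|` N -> (P X <= P Y)%E.
  move=> mX mY XY; rewrite -(measureU0 mY mN N0).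
  by apply: le_measure => //; rewrite inE//; exact: measurableU.
apply/le_anti/andP; split; apply: le_P => // w.
- by move=> Aw; have [Nw|/(contra_not (ABN w))/contrapT ABw] := pselect (N w);
    [right|left; apply/ABw].
- by move=> Bw; have [Nw|/(contra_not (ABN w))/contrapT ABw] := pselect (N w);
    [right|left; apply/ABw].
Qed.

End kolmogorov.

(** * The distance of f(F) to its Gaussian limit *)

Theorem lemma3p7 (R : realType) (theta : R) (f g : R -> R)
  (htheta : 0 < theta)
  (hfg : inverse_on_pos f g)
  (hg_der : forall x : R, 0 < x ->
     [/\ derivable g x 1, derivable g^`() x 1 & derivable g^`(2) x 1])
  (hg1 : forall x : R, 0 < x -> g^`() x < 0)
  (hg2 : forall x : R, 0 < x -> 0 < g^`(2) x)
  (hg3 : forall x : R, 0 < x -> g^`(3) x < 0) :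
  exists2 C : R, 0 < C &
    (* [Y] is the random variable f(F), which is only defined almost surely *)
    forall (T : R) (d d' : measure_display)
      (Omega : measurableType d) (Omega' : measurableType d')
      (P : probability Omega R) (Q : probability Omega' R)
      (F Y : {RV P >-> R}) (N : {RV Q >-> R}),
    0 < T ->
    {ae P, forall w, 0 < F w} ->
    ('E_P[F] < +oo)%E ->
    {ae P, forall w, 0 < f (F w)} ->
    {ae P, forall w, Y w = f (F w)} ->
    standard_normal N ->
    let m := fine 'E_P[F] in
    dKol P Q (fun w => Num.sqrt T * (Y w - theta)) N <=
    C * (dKol P Q (fun w => Num.sqrt T / `|g^`() theta| * (F w - m)) N
         + Num.sqrt T * `|m - g theta| + (Num.sqrt T)^-1).
Proof.
have [C1 C10 normal_g] := normal_cdf_decrement hg_der hg1 hg2 hg3 htheta.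
set a := `|_|; have a0 : 0 < a by rewrite normr_gt0 lt_eqF// hg1.
have ia0 : 0 < a^-1 by rewrite invr_gt0.
case: hfg => g_gt0 fgK gfK.
have dg x : 0 < x -> derivable g x 1 by move=> /hg_der[].
(* The normal tail at [s * theta], for the null events with [theta + h <= 0]. *)
pose C2 := 2 / theta.
have C20 : 0 < C2 by rewrite divr_gt0.
exists (1 + a^-1 + C1 + C2); first by rewrite !addr_gt0.
move=> T d d' Omega Omega' P Q F Y N T0 F0 _ fF0 YfF nN; cbv zeta.
set m := fine 'E_P[F].
set s := Num.sqrt T; have s0 : 0 < s by rewrite sqrtr_gt0.
have is0 : 0 < s^-1 by rewrite invr_gt0.
set U := fun w => s / a * (F w - m); set D := dKol P Q U N.
have mU : measurable_fun setT U.
  by apply: measurable_funM => //; exact: measurable_funB.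
have mV : measurable_fun setT (fun w => s * (Y w - theta)).
  by apply: measurable_funM => //; exact: measurable_funB.
have D0 : 0 <= D by apply: le_trans (dKol_normal_ge P 0 mU nN).
set e := s * `|m - g theta|.
have e0 : 0 <= e by rewrite mulr_ge0// ltW.
apply: dKol_normal_le => // z.
suff main : `|fine (P [set w | s * (Y w - theta) <= z]) - normal_cdf z| <=
    D + a^-1 * e + (C1 + C2) * s^-1.
  apply: le_trans main _; rewrite -[D in leLHS]mul1r !mulrDr.
  by rewrite !lerD// ler_wpM2r ?(ltW is0)//; lra.
pose h := z / s.
have zE : z = s * h by rewrite /h mulrC divfK// gt_eqF.
have YE w : s * (Y w - theta) <= z = (Y w <= theta + h).
  by rewrite zE ler_pM2l// lerBlDl.
have [h0|h0] := leP (theta + h) 0.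
  have -> : P [set w | s * (Y w - theta) <= z] = P set0.
    apply: ae_measure_eq => //; first exact: measurable_le.
    apply: filterS2 fF0 YfF => w fw Yw /=; split => //.
    by rewrite YE Yw => /le_trans/(_ h0); rewrite leNgt fw.
  rewrite measure0 sub0r normrN ger0_norm ?normal_cdf_ge0//.
  apply: (@le_trans _ _ (C2 * s^-1)).
    apply: (@le_trans _ _ (normal_cdf (- (s * theta)))).
      by apply: normal_cdf_le; rewrite zE -mulrN ler_pM2l//; lra.
    apply: le_trans (normal_cdf_tail _) _; first exact: mulr_gt0.
    by rewrite /C2 invfM [s^-1 * _]mulrC mulrA.
  have := mulr_ge0 (ltW ia0) e0; have := mulr_gt0 C10 is0; lra.
pose u := s / a * (g (theta + h) - m).
have -> : P [set w | s * (Y w - theta) <= z] = P (~` [set w | U w < u]).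
  apply: ae_measure_eq; first exact: measurable_le.
    by apply: measurableC; exact: measurable_lt.
  apply: filterS3 F0 fF0 YfF => w Fw fw Yw /=.
  have -> : (U w < u) = (F w < g (theta + h)).
    by rewrite /U /u ltr_pM2l ?ltrD2r// mulr_gt0.
  rewrite YE Yw; split => [fh|/negP].
    apply/negP; rewrite -leNgt -[leRHS]gfK//.
    move: fh; rewrite le_eqVlt => /predU1P[->//|fh].
    by apply/ltW/(decreasing_pos dg hg1).
  rewrite -leNgt => gF; rewrite leNgt; apply/negP => fh.
  have := decreasing_pos dg hg1 h0 fh.
  by rewrite gfK// ltNge gF.
have mlt := measurable_lt u mU.
rewrite probability_setC// fineB ?fin_num_measure//=.
have dist_U := dKol_normal_ge_lt P u mU nN.
pose v := s * ((g theta - g (theta + h)) / a).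
have shift_mean : `|normal_cdf (- u) - normal_cdf v| <= a^-1 * e.
  apply: le_trans (normal_cdf_lipschitz _ _) _.
  have -> : - u - v = s / a * (m - g theta) by rewrite /u /v; ring.
  by rewrite normrM gtr0_norm ?mulr_gt0// /e mulrCA mulrA.
have linearise : `|normal_cdf v - normal_cdf z| <= C1 * s^-1.
  by rewrite zE; exact: normal_g.
have C2_ge0 : 0 <= C2 * s^-1 by rewrite ltW// mulr_gt0.
rewrite normal_cdfN in shift_mean.
move: dist_U shift_mean linearise; rewrite -/D !ler_norml.
move=> /andP[? ?] /andP[? ?] /andP[? ?].
by apply/andP; split; lra.
Qed.
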